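(* Consider an interconnected system with matrix pair $(A,B)$ and plant graph $\mathcal{G}_p(\mathcal{V},\mathcal{E}_p)$. Suppose it is dynamically weakly coupled, i.e. there exist local feedback gains $K_{ii}\in\mathbb{R}^{m_i\times n_i}$ $(i\in\mathcal{V})$, symmetric matrices $P_i\succ0$ in $\mathbb{R}^{n_i\times n_i}$ $(i\in\mathcal{V})$, and symmetric matrices $W_{ij}\succ0$ in $\mathbb{R}^{n_j\times n_j}$ $(i\in\mathcal{V},\ j\in\mathbb{N}_i)$ such that for every $i\in\mathcal{V}$ $$(A_{ii}-B_iK_{ii})^{\mathsf T}P_i+P_i(A_{ii}-B_iK_{ii})+P_i\Big(\sum_{j\in\mathbb{N}_i}A_{ij}W_{ij}^{-1}A_{ij}^{\mathsf T}\Big)P_i+\sum_{j\in\hat{\mathbb{N}}_i}W_{ji}\prec0,$$ where $\mathbb{N}_i=\{j\mid(j,i)\in\mathcal{E}_p\}$ and $\hat{\mathbb{N}}_i=\{j\mid(i,j)\in\mathcal{E}_p\}$. Then $(A,B)\in\Sigma_2$, i.e. the system is strongly decentralized stabilizable.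
   Context: Setting. Let $\mathcal{G}_p(\mathcal{V},\mathcal{E}_p)$ be a directed graph (the plant graph) with nodes $\mathcal{V}=\{1,\ldots,N\}$ and edge set $\mathcal{E}_p\subseteq\mathcal{V}\times\mathcal{V}$ without self-loops; $(j,i)\in\mathcal{E}_p$ means that subsystem $j$ dynamically influences subsystem $i$. $\mathbb{N}_i=\{j\mid (j,i)\in\mathcal{E}_p\}$ is the set of nodes influencing node $i$, and $\hat{\mathbb{N}}_i=\{j\mid(i,j)\in\mathcal{E}_p\}$ is the set of nodes influenced by $i$. Subsystem $i$ has state $x_i\in\mathbb{R}^{n_i}$, input $u_i\in\mathbb{R}^{m_i}$ and disturbance $d_i\in\mathbb{R}^{q_i}$, with dynamics $$\dot x_i(t)=A_{ii}x_i(t)+\sum_{j\in\mathbb{N}_i}A_{ij}x_j(t)+B_iu_i(t)+M_id_i(t),$$ where all matrices are real, $A_{ij}\in\mathbb{R}^{n_i\times n_j}$, $B_i\in\mathbb{R}^{n_i\times m_i}$. The overall system is $\dot x=Ax+Bu+Md$, where $x$ stacks the $x_i$ (similarly $u,d$), $A$ has blocks $A_{ij}$ with $A_{ij}=0$ whenever $i\ne j$ and $(j,i)\notin\mathcal{E}_p$, $B=\mathrm{diag}(B_1,\ldots,B_N)$ and $M=\mathrm{diag}(M_1,\ldots,M_N)$. Strongly decentralized stabilizable: there exists a decentralized static feedback $u_i=-K_{ii}x_i$, $K_{ii}\in\mathbb{R}^{m_i\times n_i}$, $i\in\mathcal{V}$, i.e. $K=\mathrm{diag}(K_{11},\ldots,K_{NN})$,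 such that the (disturbance-free) closed-loop system $\dot x=(A-BK)x$ admits a block-diagonal Lyapunov function $V(x)=\sum_{i=1}^N x_i^{\mathsf T}P_ix_i$. That is, there are symmetric positive definite $P_i\in\mathbb{R}^{n_i\times n_i}$ such that, with $P=\mathrm{diag}(P_1,\ldots,P_N)$, $(A-BK)^{\mathsf T}P+P(A-BK)\prec 0$. $\Sigma_2$ denotes the set of pairs $(A,B)$ for which the system is strongly decentralized stabilizable. $\succ0$ and $\prec 0$ mean symmetric positive definite and symmetric negative definite, respectively. *)

(* Defs.v *)
From HB Require Import structures.
From mathcomp Require Import all_boot all_order all_algebra.
From mathcomp Require Import classical_sets reals.

Set Implicit Arguments.
Unset Strict Implicit.
Unset Printing Implicit Defensive.

Import Order.TTheory GRing.Theory Num.Theory.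
Local Open Scope ring_scope.

Definition posdefmx (R : realType) (k : nat) (P : 'M[R]_k) : Prop :=
  P \is symmetricmx /\
  forall x : 'cV[R]_k, x != 0 -> 0 < (x^T *m P *m x) 0 0.

Definition negdefmx (R : realType) (k : nat) (P : 'M[R]_k) : Prop :=
  P \is symmetricmx /\
  forall x : 'cV[R]_k, x != 0 -> (x^T *m P *m x) 0 0 < 0.

(* The library's [mxdiag] only covers square diagonal blocks. *)
Definition rect_mxdiag (R : realType) (N : nat) (p q : 'I_N -> nat)
    (D : forall i, 'M[R]_(p i, q i)) : 'M[R]_(\sum_i p i, \sum_i q i) :=
  \mxblock_(i, j) if i == j then conform_mx 0 (D i) else 0.

(* An edge (j, i) means that subsystem j influences subsystem i. *)
Definition in_nbrs (N : nat) (Ep : {set 'I_N * 'I_N}) (i : 'I_N) : {set 'I_N} :=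
  [set j | (j, i) \in Ep].

Definition out_nbrs (N : nat) (Ep : {set 'I_N * 'I_N}) (i : 'I_N) : {set 'I_N} :=
  [set j | (i, j) \in Ep].

Definition no_self_loops (N : nat) (Ep : {set 'I_N * 'I_N}) : Prop :=
  forall i, (i, i) \notin Ep.

Definition compatible (R : realType) (N : nat) (Ep : {set 'I_N * 'I_N})
    (n : 'I_N -> nat) (A : forall i j, 'M[R]_(n i, n j)) : Prop :=
  forall i j, i != j -> (j, i) \notin Ep -> A i j = 0.

(* Only the values [W i j] with [j] in [in_nbrs Ep i] are constrained or used;
   for [j] in [out_nbrs Ep i], [W j i] has the size [n i] of the i-th block. *)
Definition dynamically_weakly_coupled (R : realType) (N : nat)
    (Ep : {set 'I_N * 'I_N}) (n m : 'I_N -> nat)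
    (A : forall i j, 'M[R]_(n i, n j)) (B : forall i, 'M[R]_(n i, m i)) : Prop :=
  exists (K : forall i, 'M[R]_(m i, n i)) (P : forall i, 'M[R]_(n i))
         (W : forall i j : 'I_N, 'M[R]_(n j)),
    [/\ forall i, posdefmx (P i),
        forall i j, j \in in_nbrs Ep i -> posdefmx (W i j)
      & forall i, negdefmx
          ((A i i - B i *m K i)^T *m P i + P i *m (A i i - B i *m K i)
           + P i *m (\sum_(j in in_nbrs Ep i)
                        A i j *m invmx (W i j) *m (A i j)^T) *m P i
           + \sum_(j in out_nbrs Ep i) W j i)].

(* [V x = \sum_i x_i^T P_i x_i] is a Lyapunov function of [x' = (A - B K) x]. *)
Definition strongly_decentralized_stabilizable (R : realType) (N : nat)
    (n m : 'I_N -> nat)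
    (A : 'M[R]_(\sum_i n i)) (B : 'M[R]_(\sum_i n i, \sum_i m i)) : Prop :=
  exists (K_ : forall i, 'M[R]_(m i, n i)) (P_ : forall i, 'M[R]_(n i)),
    (forall i, posdefmx (P_ i)) /\
    let K := rect_mxdiag K_ in
    let P := \mxdiag_i P_ i in
    negdefmx ((A - B *m K)^T *m P + P *m (A - B *m K)).

Definition Sigma2 (R : realType) (N : nat) (n m : 'I_N -> nat) :
    set ('M[R]_(\sum_i n i) * 'M[R]_(\sum_i n i, \sum_i m i)) :=
  [set AB | strongly_decentralized_stabilizable AB.1 AB.2].

Arguments Sigma2 R {N} n m.

(* Main.v *)
Require Import Defs.
From mathcomp Require Import all_boot all_order all_algebra.
From mathcomp Require Import classical_sets reals.
From mathcomp Require Import lra.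
Import Order.TTheory GRing.Theory Num.Theory.
Local Open Scope ring_scope.

(** The witnesses are the gains [K i] and the matrices [P i] of the weak coupling
    hypothesis themselves.  With [S] the closed-loop matrix, the derivative of
    [V] along the trajectory through [x] is twice the sum over all [i], [j] of
    the cross terms [x_i^T P_i S_ij x_j].

    In row [i] the diagonal term already occurs in the [i]-th hypothesis, the
    terms with [j] outside the in-neighbourhood of [i] vanish because
    [A i j = 0], and each remaining term is split by Young's inequality
    weighted by [W i j] ([young_posdefmx]):
      [2 x_i^T P_i A_ij x_j
         <= x_i^T P_i A_ij W_ij^-1 A_ij^T P_i x_i + x_j^T W_ij x_j].
    The first summand is charged to node [i] and the second to node [j], which
    is where the hypothesis accounts for it: summing [W i j] over the edges by
    head (in-neighbours) or by tail (out-neighbours) gives the same total.  So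
    the derivative is at most the sum over [i] of the quadratic forms of the
    hypotheses at [x_i]; all are nonpositive, and one is negative as soon as
    [x] is nonzero. *)

Definition bform {R : realType} {p q : nat} (M : 'M[R]_(p, q))
  (u : 'cV[R]_p) (v : 'cV[R]_q) : R := (u^T *m M *m v) 0 0.

Lemma bformD {R : realType} {p q} (M M' : 'M[R]_(p, q)) u v :
  bform (M + M') u v = bform M u v + bform M' u v.
Proof. by rewrite /bform mulmxDr mulmxDl mxE. Qed.

Lemma bform_sum {R : realType} {p q} (I : finType) (D : {pred I})
    (M : I -> 'M[R]_(p, q)) u v :
  bform (\sum_(i in D) M i) u v = \sum_(i in D) bform (M i) u v.
Proof. by rewrite /bform mulmx_sumr mulmx_suml summxE. Qed.

Lemma bform_tr {R : realType} {p q} (M : 'M[R]_(p, q)) u v :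
  bform M^T v u = bform M u v.
Proof.
rewrite /bform; suff -> : v^T *m M^T *m u = (u^T *m M *m v)^T by rewrite mxE.
by rewrite !trmx_mul trmxK mulmxA.
Qed.

(** The two halves of a Lyapunov expression are transposes of each other, so
    they have the same quadratic form. *)
Lemma bform_lyap {R : realType} {k} (M P : 'M[R]_k) x :
  P^T = P -> bform (M^T *m P + P *m M) x x = 2 * bform (P *m M) x x.
Proof.
by move=> sP; rewrite bformD -{1}sP -trmx_mul bform_tr mulr_natl mulr2n.
Qed.

Lemma bform_mxblock {R : realType} {p q : nat} {a : 'I_p -> nat}
    {b : 'I_q -> nat} (M : forall i j, 'M[R]_(a i, b j)) u v :
  bform (\mxblock_(i, j) M i j) u v =
  \sum_i \sum_j bform (M i j) (submxcol u i) (submxcol v j).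
Proof.
rewrite /bform -{1}(submxcolK u) -{1}(submxcolK v) tr_mxcol.
rewrite mul_mxrow_mxblock mul_mxrow_mxcol summxE exchange_big /=.
by apply: eq_bigr => j _; rewrite mulmx_suml summxE.
Qed.

Lemma symmetricmxE {R : realType} {k} (M : 'M[R]_k) :
  (M \is symmetricmx) = (M^T == M).
Proof. by rewrite qualifE /= expr0 scale1r map_mx_id // eq_sym. Qed.

Lemma posdefmx_tr {R : realType} {k} {P : 'M[R]_k} : posdefmx P -> P^T = P.
Proof. by case; rewrite symmetricmxE => /eqP. Qed.

Lemma posdefmx_ge0 {R : realType} {k} {P : 'M[R]_k} x :
  posdefmx P -> 0 <= bform P x x.
Proof.
case=> _ P_gt0; have [->|/P_gt0/ltW//] := eqVneq x 0.
by rewrite /bform mulmx0 mxE.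
Qed.

Lemma negdefmx_le0 {R : realType} {k} {P : 'M[R]_k} x :
  negdefmx P -> bform P x x <= 0.
Proof.
case=> _ P_lt0; have [->|/P_lt0/ltW//] := eqVneq x 0.
by rewrite /bform mulmx0 mxE.
Qed.

(** A vector in the kernel would have a zero quadratic form. *)
Lemma posdefmx_unit {R : realType} {k} {P : 'M[R]_k} :
  posdefmx P -> P \in unitmx.
Proof.
case=> _ P_gt0; rewrite -row_free_unit; apply/inj_row_free => v vP0.
apply/eqP/negPn/negP; rewrite -trmx_eq0 => /P_gt0.
by rewrite trmxK vP0 mul0mx mxE ltxx.
Qed.

(** Weighted Young inequality: the gap between the two sides is the square
    [z^T W z] with [z = y - W^-1 C^T u]. *)
Lemma young_posdefmx {R : realType} {p k} (W : 'M[R]_k) (C : 'M[R]_(p, k)) u y :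
  posdefmx W ->
  2 * bform C u y <= bform (C *m invmx W *m C^T) u u + bform W y y.
Proof.
move=> W_pos; have uW := posdefmx_unit W_pos; have sW := posdefmx_tr W_pos.
have := posdefmx_ge0 (y - invmx W *m C^T *m u) W_pos.
have sVW : (invmx W)^T = invmx W by rewrite trmx_inv sW.
suff -> : bform W (y - invmx W *m C^T *m u) (y - invmx W *m C^T *m u) =
  bform W y y - 2 * bform C u y + bform (C *m invmx W *m C^T) u u by lra.
rewrite /bform [(y - _)^T]linearB /= !trmx_mul trmxK sVW !mulmxBl !mulmxBr !mulmxA.
rewrite !mulmxKV // !mulmxK //.
have entryB (X Y : 'M[R]_1) : (X - Y) 0 0 = X 0 0 - Y 0 0 by rewrite !mxE.
rewrite !entryB.
have -> : (y^T *m C^T *m u) 0 0 = (u^T *m C *m y) 0 0.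
  exact: (bform_tr C u y).
lra.
Qed.

Lemma mul_rect_mxdiag {R : realType} {N : nat} {p q r : 'I_N -> nat}
    (D : forall i, 'M[R]_(p i, q i)) (E : forall i, 'M[R]_(q i, r i)) :
  rect_mxdiag D *m rect_mxdiag E = rect_mxdiag (fun i => D i *m E i).
Proof.
rewrite /rect_mxdiag mul_mxblock; apply: eq_mxblock => i j.
rewrite (bigD1 i) //= big1 => [|l nli]; last first.
  by rewrite eq_sym (negPf nli) mul0mx.
rewrite addr0 eqxx; case: eqP => [ij|_]; last by rewrite mulmx0.
(* Once the indices are identified, every [conform_mx] is between equal sizes. *)
by case: j / ij; rewrite !conform_mx_id.
Qed.

Theorem proposition3 (R : realType) (N : nat) (Ep : {set 'I_N * 'I_N})
    (n m : 'I_N -> nat)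
    (A : forall i j : 'I_N, 'M[R]_(n i, n j))
    (B : forall i : 'I_N, 'M[R]_(n i, m i))
    (Ep_loopless : no_self_loops Ep)
    (A_Ep : compatible Ep A)
    (AB_dwc : dynamically_weakly_coupled Ep A B) :
  Sigma2 R n m (\mxblock_(i, j) A i j, rect_mxdiag B).
Proof.
case: AB_dwc => K [P] [W] [P_pos W_pos G_neg].
exists K, P; split=> //=.
(* The closed-loop matrix has [B i *m K i] subtracted on the diagonal blocks
   only. *)
rewrite mul_rect_mxdiag /rect_mxdiag -mxblockB.
set S := (fun i j => A i j - _).
have Sd i : S i i = A i i - B i *m K i by rewrite /S eqxx conform_mx_id.
have So i j : i != j -> S i j = A i j.
  by move=> /negPf nij; rewrite /S nij subr0.
have sP : (\mxdiag_i P i)^T = \mxdiag_i P i.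
  by rewrite tr_mxdiag; apply: eq_mxdiag => i; apply: posdefmx_tr.
split.
  rewrite symmetricmxE linearD /= !trmx_mul sP trmxK addrC; exact: eqxx.
move=> x x_neq0; rewrite -/(bform _ x x) bform_lyap // mul_mxdiag_mxblock.
rewrite bform_mxblock; set y := submxcol x.
(* Young's inequality splits the coupling along the edge (j, i) into a cost
   [c i j] borne by its head i and a cost [w i j] borne by its tail j. *)
pose c i j :=
  bform (P i *m A i j *m invmx (W i j) *m (P i *m A i j)^T) (y i) (y i).
pose w i j := bform (W i j) (y j) (y j).
pose g i := 2 * bform (P i *m S i i) (y i) (y i)
  + \sum_(j in in_nbrs Ep i) c i j + \sum_(j in out_nbrs Ep i) w j i.
have gE i : g i = bform ((A i i - B i *m K i)^T *m P i
           + P i *m (A i i - B i *m K i)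
           + P i *m (\sum_(j in in_nbrs Ep i)
                        A i j *m invmx (W i j) *m (A i j)^T) *m P i
           + \sum_(j in out_nbrs Ep i) W j i) (y i) (y i).
  rewrite bformD [in RHS]bformD bform_lyap ?(posdefmx_tr (P_pos i)) // -Sd.
  rewrite mulmx_sumr mulmx_suml !bform_sum /g; congr (_ + _ + _).
  apply: eq_bigr => j _.
  by rewrite /c trmx_mul (posdefmx_tr (P_pos i)) !mulmxA.
have g_le0 i : g i <= 0 by rewrite gE; apply: negdefmx_le0.
have [i0 yi0] : exists i, y i != 0.
  apply/existsP; rewrite -negb_forall; apply: contra x_neq0 => /forallP y0.
  apply/eqP/mxcolP => i; rewrite submxcol0; exact/eqP.
have row_le i : 2 * \sum_j bform (P i *m S i j) (y i) (y j) <=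
    2 * bform (P i *m S i i) (y i) (y i)
    + \sum_(j in in_nbrs Ep i) c i j + \sum_(j in in_nbrs Ep i) w i j.
  rewrite (bigD1 i) //= mulrDr -addrA lerD2l -big_split mulr_sumr /=.
  rewrite (bigID (mem (in_nbrs Ep i))) /= [X in _ + X]big1 ?addr0; last first.
    move=> j /andP[nji]; rewrite inE => nE.
    rewrite So 1?eq_sym // A_Ep 1?eq_sym // mulmx0.
    by rewrite /bform mulmx0 mul0mx mxE mulr0.
  have in_neq j : j \in in_nbrs Ep i -> j != i.
    by rewrite inE; apply: contraTneq => ->; apply: Ep_loopless.
  rewrite (eq_bigl (mem (in_nbrs Ep i))) => [|j]; last first.
    by apply: andb_idl; apply: in_neq.
  apply: ler_sum => j jN; rewrite So 1?eq_sym ?in_neq //.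
  by apply: young_posdefmx; apply: W_pos.
apply: (@le_lt_trans _ _ (\sum_i g i)).
  (* The row bounds list the costs [w] by the head of each edge, the [g i] by
     its tail. *)
  rewrite mulr_sumr; apply: (le_trans (ler_sum _ (fun i _ => row_le i))).
  rewrite !big_split /= lerD2l (exchange_big_dep xpredT) //=.
  rewrite le_eqVlt; apply/orP; left; apply/eqP; apply: eq_bigr => j _.
  by apply: eq_bigl => i; rewrite !inE.
rewrite (bigD1 i0) //= -[ltRHS]addr0; apply: ltr_leD; last exact: sumr_le0.
by rewrite gE; case: (G_neg i0) => _; apply.
Qed.
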